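(* Let $N\ge1$, let $A\in\mathcal{P}_N(\mathbb{C})$, and let $\{I_1,\dots,I_k\}$ be the unique partition of $\{1,\dots,N\}$ such that (1) for each $j$, all entries of the diagonal block $A_{I_j}$ are equal to a single number $\alpha_j\ge0$, and (2) the diagonal blocks have maximal size, i.e. no $I_j$ is properly contained in a set $J\subset\{1,\dots,N\}$ such that all entries of $A_J$ are equal. Fix $B\in\mathcal{P}_N(\mathbb{C})$ with no zero diagonal entries, and let $c_0,\dots,c_{N-1}>0$. Then $$\ker\bigl(B\circ(c_0\mathbf{1}_{N\times N}+c_1A+\cdots+c_{N-1}A^{\circ(N-1)})\bigr)=\bigcap_{n\ge0}\ker(B\circ A^{\circ n})=\ker B_{I_1}\oplus\cdots\oplus\ker B_{I_k},$$ where $B_{I_j}$ are the diagonal blocks of $B$ corresponding to the partition $\{I_1,\dots,I_k\}$.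
   Context: $\mathcal{P}_N(\mathbb{C})$ is the set of complex positive semidefinite $N\times N$ matrices. $X\circ Y=(x_{ij}y_{ij})$ is the Hadamard (entrywise) product; $A^{\circ n}:=(a_{ij}^n)$, with $A^{\circ0}=\mathbf{1}_{N\times N}$ the matrix with all entries $1$. For $I\subset\{1,\dots,N\}$, $A_I$ is the principal submatrix of $A$ with rows and columns indexed by $I$ (the diagonal block). The direct sum $\ker B_{I_1}\oplus\cdots\oplus\ker B_{I_k}$ is regarded as a subspace of $\mathbb{C}^N=\mathbb{C}^{I_1}\oplus\cdots\oplus\mathbb{C}^{I_k}$. *)

(* Defs.v *)
From HB Require Import structures.
From mathcomp Require Import all_boot all_order all_algebra sesquilinear spectral.
From mathcomp Require Import complex.
From mathcomp Require Import boolp classical_sets reals.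

Set Implicit Arguments.
Unset Strict Implicit.
Unset Printing Implicit Defensive.

Import Order.TTheory GRing.Theory Num.Theory.

Local Open Scope ring_scope.
Local Open Scope sesquilinear_scope.
Local Open Scope classical_set_scope.

(* The order on a numClosedFieldType is partial: 0 <= z says that z is real and
   nonnegative. *)
Definition psdmx (C : numClosedFieldType) (N : nat) (A : 'M[C]_N) : Prop :=
  A \is hermsymmx /\ forall x : 'cV[C]_N, 0 <= (x ^t* *m A *m x) 0 0.

Definition hadamard (C : pzRingType) (N : nat) (X Y : 'M[C]_N) : 'M[C]_N :=
  map2_mx *%R X Y.

(* hadamard_exp A 0 has all entries 1, including where A vanishes. *)
Definition hadamard_exp (C : pzRingType) (N : nat) (A : 'M[C]_N) (n : nat) :
  'M[C]_N := map_mx (fun a => a ^+ n) A.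

(* Rows and columns are taken in the increasing order of I. *)
Definition princ_submx (C : Type) (N : nat) (A : 'M[C]_N) (I : {set 'I_N}) :
  'M[C]_(#|I|) := mxsub (@enum_val _ (mem I)) (@enum_val _ (mem I)) A.

Definition const_blocks_partition (C : numClosedFieldType) (N : nat)
    (A : 'M[C]_N) (P : {set {set 'I_N}}) : Prop :=
  [/\ finset.partition P [set: 'I_N]%SET,
      forall I, I \in P ->
        exists2 alpha : C, 0 <= alpha & princ_submx A I = const_mx alpha &
      forall I J : {set 'I_N}, I \in P -> I \proper J ->
        ~ exists a : C, princ_submx A J = const_mx a].

(* The kernel acting on column vectors; the library's kermx is the left
   kernel. *)
Definition mxker (C : pzRingType) (m n : nat) (A : 'M[C]_(m, n)) :
  set 'cV[C]_n := [set x | A *m x = 0].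

(* The canonical embedding of C^I into C^N, extending vectors by zero: the
   columns of the matrix are the e_i for i in I. *)
Definition embed_block (C : pzRingType) (N : nat) (I : {set 'I_N})
    (y : 'cV[C]_(#|I|)) : 'cV[C]_N :=
  colsub (@enum_val _ (mem I)) 1%:M *m y.

(* The sum over I in P of the subspaces V I of C^I, inside C^N; it is direct
   when the sets in P are pairwise disjoint. *)
Definition block_dsum (C : pzRingType) (N : nat) (P : {set {set 'I_N}})
    (V : forall I : {set 'I_N}, set 'cV[C]_(#|I|)) : set 'cV[C]_N :=
  [set x | exists2 y : (forall I : {set 'I_N}, 'cV[C]_(#|I|)),
     (forall I, I \in P -> V I (y I)) &
     x = \sum_(I in P) embed_block (y I)].

(* Main.v *)
Require Import Defs.
From HB Require Import structures.
From mathcomp Require Import all_boot all_order all_algebra sesquilinear spectral.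
From mathcomp Require Import complex.
From mathcomp Require Import boolp classical_sets reals.

Set Implicit Arguments.
Unset Strict Implicit.
Unset Printing Implicit Defensive.

Import Order.TTheory GRing.Theory Num.Theory.

Local Open Scope ring_scope.
Local Open Scope classical_set_scope.

(** Let M be the matrix whose kernel is computed, and call two indices i, j
    equivalent when columns i and j of A are equal. If A i i = A i j = A j j,
    then e_i - e_j is isotropic for A, hence in its kernel, and columns i and j
    agree; so the constant principal blocks of A are the sets of equivalent
    indices, and the maximal ones are the classes ([psdmx_constP],
    [const_blocks_partitionP]). This gives existence and uniqueness of the
    partition.

    Write B o A^n for the entrywise product of B with the n-th entrywise power of
    A. Schur's product theorem ([psdmx_hadamard]) makes every B o A^n positive
    semidefinite, so a vector x killed by the positive
    combination M is killed by each B o A^n with n < N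
    ([mxker_psd_combination]). Row i of these N equations reads
    sum_j B i j x_j (A i j)^n = 0, and a row of A has at most N distinct entries;
    Lagrange interpolation then gives sum_(j | A i j = z) B i j x_j = 0 for every
    value z ([fiber_sum_eq0]). Take z = A i i. The set {j | A i j = A i i} is the
    union of the block I of i and of blocks J whose diagonal value is strictly
    larger. Going down along the diagonal values, one may assume that x_J is in
    ker B_J for these J; since B is positive semidefinite, B then kills the
    extension of x_J by zero, including in the rows outside J
    ([psdmx_ker_princ_submx]), and what is left of the equation says that x_I is
    in ker B_I ([ker_hadamard_restrict]).

    Conversely, if every x_I is in ker B_I, then B kills the extension of each x_I
    by zero, and (A i j)^n is constant for j in I, so every B o A^n kills x
    ([hadamard_exp_ker]); this closes the cycle of inclusions between the three
    spaces of the theorem. *)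

(** * Positive semidefinite matrices *)

Section Psd.
Local Open Scope sesquilinear_scope.
Variables (C : numClosedFieldType) (N : nat).
Implicit Types (A B : 'M[C]_N) (x : 'cV[C]_N) (I : {set 'I_N}).

Definition quad_form A x : C := (x ^t* *m A *m x) 0 0.

Lemma quad_formE A x :
  quad_form A x = \sum_i \sum_j (x i 0)^* * A i j * x j 0.
Proof.
rewrite /quad_form mxE exchange_big /=; apply: eq_bigr => j _.
by rewrite mxE big_distrl; apply: eq_bigr => i _; rewrite !mxE.
Qed.

Lemma psdmx_conj A i j : psdmx A -> A j i = (A i j)^*.
Proof. by case=> /is_hermitianmxP/matrixP/(_ j i); rewrite !mxE expr0 mul1r. Qed.

Lemma sesqui_delta A i j :
  ((delta_mx i 0 : 'cV_N)^t* *m A *m (delta_mx j 0 : 'cV_N)) 0 0 = A i j.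
Proof. by rewrite -colE mxE trmx_delta map_delta_mx -rowE mxE. Qed.

Lemma quad_form_delta A i : quad_form A (delta_mx i 0) = A i i.
Proof. exact: sesqui_delta. Qed.

Lemma quad_form_deltaB A i j :
  quad_form A (delta_mx i 0 - delta_mx j 0) = A i i - A i j - A j i + A j j.
Proof.
rewrite /quad_form [_^T]linearB /= map_mxB mulmxBl mulmxBr !mulmxBl.
have Q (a b c d : 'M[C]_1) :
    (a - b - (c - d)) 0 0 = a 0 0 - b 0 0 - c 0 0 + d 0 0.
  by rewrite !mxE opprB addrA addrAC.
by rewrite Q !sesqui_delta; congr (_ + _); rewrite addrAC.
Qed.

(** A unitary diagonalization A = P^* D P has nonnegative eigenvalues, so that
    S = D^(1/2) P will do. *)
Lemma psdmx_gram A : psdmx A -> exists S : 'M[C]_N, A = S ^t* *m S.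
Proof.
move=> [Ah Ap]; have /hermitian_normalmx/orthomx_spectralP := Ah.
have Pu := spectral_unitarymx A; rewrite invmx_unitary //.
move: (spectralmx A) (spectral_diag A) Pu => P d /unitarymxP Pu Ad.
have d_ge0 k : 0 <= d 0 k.
  have := Ap (P ^t* *m delta_mx k 0); rewrite Ad trmx_mul map_mxM.
  rewrite map_trmx trmxK -map_mx_comp (map_mx_id (@conjCK _)) !mulmxA.
  rewrite -(mulmxA _ P (P ^t*)) Pu mulmx1.
  rewrite -(mulmxA _ P (P ^t*)) Pu mulmx1.
  by rewrite -/(quad_form _ _) quad_form_delta mxE eqxx mulr1n.
exists (diag_mx (map_mx sqrtC d) *m P).
rewrite trmx_mul map_mxM /= tr_diag_mx map_diag_mx mulmxA -(mulmxA (P ^t*)).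
rewrite mulmx_diag {1}Ad; congr (_ *m diag_mx _ *m _).
apply/rowP => k; rewrite !mxE /= geC0_conj ?sqrtC_ge0 //.
by rewrite -expr2 sqrtCK.
Qed.

(** With A = S^* S the quadratic form is the squared norm of S x. *)
Lemma psdmx_isotropic A x : psdmx A -> quad_form A x = 0 -> A *m x = 0.
Proof.
move=> /psdmx_gram[S ->] q0; rewrite -mulmxA.
suff -> : S *m x = 0 by rewrite mulmx0.
have := q0; rewrite /quad_form mulmxA -map_mxM -trmx_mul -mulmxA mxE => s0.
have E l : (S *m x)^t* 0 l = ((S *m x) l 0)^* by rewrite !mxE.
apply/colP => k; rewrite [RHS]mxE; apply/eqP; rewrite -mul_conjC_eq0 mulrC -E.
apply/eqP; apply: (psumr_eq0P _ s0) => // l _.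
by rewrite E mulrC mul_conjC_ge0.
Qed.

(** Schur's product theorem: a Gram factorization of A writes the quadratic
    form of the Hadamard product as a sum of values of that of B. *)
Lemma psdmx_hadamard A B : psdmx A -> psdmx B -> psdmx (hadamard B A).
Proof.
move=> hA hB; split.
  apply/is_hermitianmxP/matrixP => i j; rewrite !mxE expr0 mul1r.
  by rewrite (psdmx_conj i j hA) (psdmx_conj i j hB) rmorphM /= !conjCK.
move=> x; rewrite -/(quad_form _ _).
have [S AS] := psdmx_gram hA.
suff -> : quad_form (hadamard B A) x =
    \sum_k quad_form B (\col_j (S k j * x j 0)).
  by apply: sumr_ge0 => k _; case: hB => _; apply.
under [RHS]eq_bigr do rewrite quad_formE.
rewrite quad_formE [RHS]exchange_big; apply: eq_bigr => i _.
rewrite [RHS]exchange_big; apply: eq_bigr => j _ /=.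
rewrite !mxE {1}AS mxE big_distrr /= big_distrr big_distrl /=.
apply: eq_bigr => k _; rewrite !mxE rmorphM /=.
by rewrite -!mulrA [in RHS]mulrCA; congr (_ * _); rewrite mulrCA.
Qed.

Lemma psdmx_hadamard_exp A B n :
  psdmx A -> psdmx B -> psdmx (hadamard B (hadamard_exp A n)).
Proof.
move=> hA hB; elim: n => [|n IH].
  suff -> : hadamard B (hadamard_exp A 0) = B by [].
  by apply/matrixP => i j; rewrite !mxE expr0 mulr1.
have -> : hadamard B (hadamard_exp A n.+1) =
    hadamard (hadamard B (hadamard_exp A n)) A.
  by apply/matrixP => i j; rewrite !mxE exprSr mulrA.
exact: psdmx_hadamard.
Qed.

(** The quadratic forms of the summands are nonnegative, so all of them vanish
    where their positive combination does. *)
Lemma mxker_psd_combination n (M : 'I_n -> 'M[C]_N) (c : 'I_n -> C) x :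
  (forall k, psdmx (M k)) -> (forall k, 0 < c k) ->
  (\sum_k c k *: M k) *m x = 0 -> forall k, M k *m x = 0.
Proof.
move=> hM hc Mx k; apply: psdmx_isotropic => //.
have s0 : \sum_k c k * quad_form (M k) x = 0.
  transitivity (quad_form (\sum_k c k *: M k) x); last first.
    by rewrite /quad_form -mulmxA Mx mulmx0 mxE.
  rewrite /quad_form mulmx_sumr mulmx_suml summxE; apply: eq_bigr => l _.
  by rewrite -scalemxAr -scalemxAl [RHS]mxE.
have q_ge0 l : 0 <= quad_form (M l) x by case: (hM l) => _; apply.
have := psumr_eq0P (fun l _ => mulr_ge0 (ltW (hc l)) (q_ge0 l)) s0.
by move=> /(_ k isT)/eqP; rewrite mulf_eq0 gt_eqF //= => /eqP.
Qed.

(** * Equal columns *)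

(** Under the hypothesis, the quadratic form of A takes the value A j j - A i i
    at e_i - e_j. *)
Lemma psdmx_diag_le A i j : psdmx A -> A i j = A i i -> A i i <= A j j.
Proof.
move=> hA Aij; have [_ /(_ (delta_mx i 0 - delta_mx j 0))] := hA.
rewrite -/(quad_form _ _) quad_form_deltaB (psdmx_conj i j hA) Aij.
by rewrite -(psdmx_conj i i hA) subrr sub0r addrC subr_ge0.
Qed.

Lemma psdmx_eq_col A i j :
  psdmx A -> A i j = A i i -> A j j = A i i -> col j A = col i A.
Proof.
move=> hA Aij Ajj; have := @psdmx_isotropic A (delta_mx i 0 - delta_mx j 0) hA.
rewrite quad_form_deltaB (psdmx_conj i j hA) Aij Ajj -(psdmx_conj i i hA).
rewrite subrr sub0r addNr mulmxBr -!colE => /(_ erefl)/eqP.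
by rewrite subr_eq0 => /eqP ->.
Qed.

Lemma psdmx_eq_col_diag A i j : psdmx A -> col j A = col i A -> A j j = A i i.
Proof.
move=> hA /colP ij; have := ij i; have := ij j; rewrite !mxE => -> Aij.
by rewrite (psdmx_conj i j hA) Aij -(psdmx_conj i i hA).
Qed.

Lemma princ_submx_constP A I (a : C) :
  princ_submx A I = const_mx a <-> {in I &, forall i j, A i j = a}.
Proof.
split=> [/matrixP AI i j iI jI|AI]; last first.
  by apply/matrixP => p q; rewrite !mxE AI // enum_valP.
have := AI (enum_rank_in iI i) (enum_rank_in iI j).
by rewrite !mxE !enum_rankK_in.
Qed.

(** A principal block with constant entries is a set of equal columns: this is
    the case of equality in the Cauchy-Schwarz inequality for the Gram vectors
    of A. *)
Lemma psdmx_constP A I : psdmx A ->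
  (exists a, princ_submx A I = const_mx a) <->
  {in I &, forall i j, col j A = col i A}.
Proof.
move=> hA; split=> [[a /princ_submx_constP AI] i j iI jI|AI].
  by apply: psdmx_eq_col; rewrite ?AI.
have [-> | [i iI]] := set_0Vmem I.
  by exists 0; apply/princ_submx_constP => k; rewrite inE.
have E : {in I &, forall k l, A k l = A k i}.
  by move=> k l kI lI; have /colP/(_ k) := AI i l iI lI; rewrite !mxE.
have Ei : {in I, forall k, A k i = A i i}.
  move=> k kI.
  by rewrite (psdmx_conj i k hA) (E i k) // -(psdmx_conj i i hA).
by exists (A i i); apply/princ_submx_constP => k l kI lI; rewrite E ?Ei.
Qed.

Definition col_partition A : {set {set 'I_N}} :=
  preim_partition (fun i => col i A) [set: 'I_N]%SET.

Lemma mem_col_partition A I i j : I \in col_partition A -> i \in I ->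
  (j \in I) = (col j A == col i A).
Proof.
by case/imsetP=> k _ ->; rewrite !inE /= eq_sym => /eqP ->; rewrite eq_sym.
Qed.

Lemma const_blocks_partitionP A P :
  psdmx A -> const_blocks_partition A P <-> P = col_partition A.
Proof.
move=> hA; split=> [[Ppart Pconst Pmax]|->].
- have memP I i j : I \in P -> i \in I -> (j \in I) = (col j A == col i A).
    move=> IP iI; apply/idP/eqP => [jI|ji].
      have [a _ ha] := Pconst _ IP.
      by apply: (proj1 (psdmx_constP I hA)) => //; exists a.
    apply: contraT => jI; case: (Pmax I (j |: I)%SET IP); last first.
      apply/psdmx_constP => //.
      (* a column equal to those of I enlarges I to a constant block *)
      suff E : {in (j |: I)%SET, forall k, col k A = col i A}.
        by move=> k l kJ lJ; rewrite !E.
      move=> k /setU1P[->//|kI]; have [a _ ha] := Pconst _ IP.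
      by apply: (proj1 (psdmx_constP I hA)) => //; exists a.
    by apply: properUr; rewrite finset.sub1set.
  rewrite -(preim_partition_pblock Ppart); apply: eq_imset => i.
  apply/setP => j; rewrite !inE /= [in RHS]eq_sym.
  have [/eqP cP tP _] := and3P Ppart.
  have iP k : k \in finset.cover P by rewrite cP inE.
  by rewrite eq_pblock // (memP _ i) ?pblock_mem ?mem_pblock.
- have memP := @mem_col_partition A; split=> [|I IP|I J IP].
  + exact: preim_partitionP.
  + have := proj2 (psdmx_constP I hA).
    case=> [i j iI jI|a ha].
      by apply/eqP; rewrite -(memP I).
    have [I0|[i iI]] := set_0Vmem I.
      exists 0 => //; apply/princ_submx_constP => k; rewrite I0 inE //.
    exists a => //; rewrite -(proj1 (princ_submx_constP A I a) ha i i iI iI).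
    by rewrite -quad_form_delta; case: hA => _; apply.
  + case/properP=> IJ [j jJ jI] /(psdmx_constP J hA) JA.
    have [I0|[i iI]] := set_0Vmem I.
      by have /and3P[_ _] := preim_partitionP (fun i => col i A) [set: 'I_N]%SET;
         rewrite -/(col_partition A) -I0 IP.
    by case/negP: jI; rewrite (memP I i) // (JA i j) //; apply: fintype.subsetP iI.
Qed.


(** * Direct sums of kernels of diagonal blocks *)

Definition restrict_to I x : 'cV[C]_N := \col_i (if i \in I then x i 0 else 0).

Lemma mulmx_restrict A I x i :
  (A *m restrict_to I x) i 0 = \sum_(j in I) A i j * x j 0.
Proof.
rewrite mxE [RHS]big_mkcond; apply: eq_bigr => j _; rewrite mxE.
by case: ifP => // _; rewrite mulr0.
Qed.

Lemma embed_blockE I (y : 'cV[C]_#|I|) p : embed_block y (enum_val p) 0 = y p 0.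
Proof.
rewrite /embed_block mxE (bigD1 p) //= big1 ?addr0 => [|q qp].
  by rewrite !mxE eqxx mul1r.
by rewrite !mxE (inj_eq enum_val_inj) eq_sym (negPf qp) mul0r.
Qed.

Lemma embed_block_out I (y : 'cV[C]_#|I|) i :
  i \notin I -> embed_block y i 0 = 0.
Proof.
move=> iI; rewrite /embed_block mxE big1 // => q _; rewrite !mxE.
by case: eqP => [E|]; [rewrite E enum_valP in iI | rewrite mul0r].
Qed.

Lemma embed_block_restrict I x :
  embed_block (rowsub (@enum_val _ (mem I)) x) = restrict_to I x.
Proof.
apply/colP => i; rewrite [RHS]mxE; have [iI|iI] := boolP (i \in I).
  by rewrite -(enum_rankK_in iI iI) embed_blockE mxE.
exact: embed_block_out.
Qed.

Lemma princ_submx_mul B I (y : 'cV[C]_#|I|) :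
  princ_submx B I *m y = rowsub (@enum_val _ (mem I)) (B *m embed_block y).
Proof.
rewrite /princ_submx /embed_block mulmxA mulmx_colsub mulmx1.
by rewrite -mul_rowsub_mx; congr (_ *m _); apply/matrixP => i j; rewrite !mxE.
Qed.

Lemma quad_form_embed_block B I (y : 'cV[C]_#|I|) :
  quad_form B (embed_block y) = (y^t* *m (princ_submx B I *m y)) 0 0.
Proof.
rewrite princ_submx_mul /quad_form -mulmxA {1}/embed_block.
rewrite trmx_mul map_mxM -mulmxA [in RHS]rowsubE.
congr ((_ *m (_ *m _)) 0 0); apply/matrixP => p q.
by rewrite !mxE rmorph_nat eq_sym.
Qed.

(** The rows of B outside I vanish on ker B_I as well: the extension by zero of
    a vector of ker B_I is isotropic for B. *)
Lemma psdmx_ker_princ_submx B I (y : 'cV[C]_#|I|) : psdmx B ->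
  princ_submx B I *m y = 0 <-> B *m embed_block y = 0.
Proof.
move=> hB; split=> [By|By]; last first.
  by rewrite princ_submx_mul By; apply/colP => i; rewrite !mxE.
by apply: psdmx_isotropic; rewrite // quad_form_embed_block By mulmx0 mxE.
Qed.

Lemma psdmx_ker_restrict B I x : psdmx B ->
  {in I, forall i, (B *m restrict_to I x) i 0 = 0} -> B *m restrict_to I x = 0.
Proof.
move=> hB Bx; rewrite -embed_block_restrict.
apply/psdmx_ker_princ_submx; rewrite // princ_submx_mul embed_block_restrict.
by apply/colP => p; rewrite [LHS]mxE Bx ?enum_valP // mxE.
Qed.

Lemma block_dsum_kerP B P x : psdmx B -> finset.partition P [set: 'I_N]%SET ->
  block_dsum P (fun I => mxker (princ_submx B I)) x <->
  {in P, forall I, B *m restrict_to I x = 0}.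
Proof.
move=> hB Ppart; split=> [[y By ->] I IP|Bx].
  suff -> : restrict_to I (\sum_(J in P) embed_block (y J)) = embed_block (y I).
    by apply/psdmx_ker_princ_submx => //; exact: By.
  apply/colP => i; rewrite mxE; case: ifPn => [iI|iI]; last first.
    by rewrite embed_block_out.
  rewrite summxE (bigD1 I) //= big1 ?addr0 // => J /andP[JP JI].
  apply: embed_block_out; apply: contra JI => iJ.
  have tP := partition_trivIset Ppart.
  by rewrite -(def_pblock tP JP iJ) (def_pblock tP IP iI).
exists (fun I => rowsub (@enum_val _ (mem I)) x) => [I IP|].
  by apply/psdmx_ker_princ_submx; rewrite // embed_block_restrict Bx.
under eq_bigr do rewrite embed_block_restrict.
apply/colP => i; rewrite summxE.
have iP : i \in finset.cover P by rewrite (cover_partition Ppart) inE.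
rewrite (bigD1 (finset.pblock P i)) ?finset.pblock_mem //=.
rewrite mxE finset.mem_pblock iP.
rewrite big1 ?addr0 // => J /andP[JP JI]; rewrite mxE ifN //.
apply: contra JI => iJ.
by rewrite (def_pblock (partition_trivIset Ppart) JP iJ).
Qed.

Lemma mulmx_restrict_partition (M : 'M[C]_N) P x i :
  finset.partition P [set: 'I_N]%SET ->
  (M *m x) i 0 = \sum_(I in P) \sum_(j in I) M i j * x j 0.
Proof.
move=> Ppart; rewrite -(set_partition_big _ Ppart) mxE.
by apply: eq_bigl => j; rewrite inE.
Qed.

(** * Separating the values of the entries *)

(** A weighted sum of the powers of N values with exponents below N determines
    the total weight of each value: evaluate at the values the polynomial of
    degree below N that vanishes at all of them but z. *)
Lemma fiber_sum_eq0 (a w : 'I_N -> C) z :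
  (forall n : 'I_N, \sum_j w j * a j ^+ n = 0) ->
  \sum_(j | a j == z) w j = 0.
Proof.
move=> wa; have [/existsP[j0 /eqP az]|/existsPn z_out] :=
  boolP [exists j, a j == z]; last by rewrite big_pred0 // => j; exact/negbTE.
pose s := [seq t <- undup (codom a) | t != z].
pose p := \prod_(t <- s) ('X - t%:P).
have sp : (size p <= N)%N.
  rewrite size_prod_XsubC; apply: (@leq_trans (size (undup (codom a)))).
    rewrite size_filter -(count_predC (pred1 z)) -add1n leq_add2r -has_count.
    by apply/hasP; exists z; rewrite /= ?mem_undup ?eqxx // -az codom_f.
  by rewrite (leq_trans (size_undup _)) // size_codom card_ord.
have wp : \sum_j w j * p.[a j] = 0.
  under eq_bigr do rewrite (horner_coef_wide _ sp) big_distrr /=.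
  rewrite exchange_big big1 //= => n _.
  under eq_bigr do rewrite mulrCA.
  by rewrite -big_distrr /= wa mulr0.
have pz : p.[z] != 0.
  by rewrite -[_ == 0]/(root p z) root_prod_XsubC mem_filter eqxx.
have pa j : a j != z -> p.[a j] = 0.
  move=> aj; apply/eqP; rewrite -[_ == 0]/(root p _) root_prod_XsubC.
  by rewrite mem_filter aj mem_undup codom_f.
move: wp; rewrite (bigID (fun j => a j == z)) /= [X in _ + X]big1 ?addr0.
  under eq_bigr => j /eqP -> do [].
  by rewrite -big_distrl => /eqP; rewrite mulf_eq0 (negPf pz) orbF => /eqP.
by move=> j /pa ->; rewrite mulr0.
Qed.

(** In row i, the entries of A equal to A i i occupy the block of i and, beyond
    it, only blocks with a larger diagonal value, whose contributions vanish by
    induction downwards along the diagonal values. *)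
Lemma ker_hadamard_restrict A B x : psdmx A -> psdmx B ->
  (forall n : 'I_N, hadamard B (hadamard_exp A n) *m x = 0) ->
  {in col_partition A, forall I, B *m restrict_to I x = 0}.
Proof.
move=> hA hB Bx.
have fiber i : \sum_(j | A i j == A i i) B i j * x j 0 = 0.
  apply: (@fiber_sum_eq0 (A i)) => n.
  have /colP/(_ i) := Bx n; rewrite mxE [RHS]mxE => {2}<-.
  by apply: eq_bigr => j _; rewrite !mxE mulrAC.
suff above m I i : I \in col_partition A -> i \in I ->
    (#|[set k | (A i i < A k k)%R]%SET| < m)%N -> B *m restrict_to I x = 0.
  move=> I IP; have [I0|[i iI]] := set_0Vmem I; last exact: (above _ I i).
  have /and3P[_ _] := preim_partitionP (fun i => col i A) [set: 'I_N]%SET.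
  by rewrite -/(col_partition A) -I0 IP.
(* m bounds the number of larger diagonal entries: the order on C is partial,
   and this count decreases strictly along it. *)
elim: m I i => // m IH I i0 IP i0I lem; apply: psdmx_ker_restrict => // i iI.
have Ppart : finset.partition (col_partition A) [set: 'I_N]%SET.
  exact: preim_partitionP.
have colJ J j k :
    J \in col_partition A -> j \in J -> k \in J -> col k A = col j A.
  by move=> JP jJ kJ; apply/eqP; rewrite -(mem_col_partition k JP jJ).
have rowJ J j k :
    J \in col_partition A -> j \in J -> k \in J -> A i k = A i j.
  by move=> JP jJ kJ; have /colP/(_ i) := colJ J j k JP jJ kJ; rewrite !mxE.
have Aii0 : A i i = A i0 i0 by apply: psdmx_eq_col_diag => //; exact: (colJ I).
have tP := partition_trivIset Ppart.
have := fiber i.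
rewrite (eq_bigl (fun j => (j \in [set: 'I_N]%SET) && (A i j == A i i)));
  last by move=> j; rewrite inE.
rewrite (set_partition_big_cond _ Ppart) (bigD1 I) //=.
rewrite [X in _ + X]big1 ?addr0 => [|J /andP[JP JI]].
  rewrite mulmx_restrict => fI; rewrite -[RHS]fI; apply: eq_bigl => j.
  by have [jI|//] := boolP (j \in I); rewrite (rowJ I i j) // eqxx.
have [/existsP[j /andP[jJ /eqP Aij]]|/existsPn J_out] :=
    boolP [exists j, (j \in J) && (A i j == A i i)];
  last by rewrite big_pred0 // => j; exact/negbTE.
(* If j had the same diagonal entry, it would be in I. *)
have ij : A i i < A j j.
  rewrite lt_neqAle psdmx_diag_le // andbT eq_sym; apply: contra JI => /eqP Ajj.
  have jI : j \in I.
    by rewrite (mem_col_partition j IP iI); apply/eqP/psdmx_eq_col.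
  by rewrite -(def_pblock tP JP jJ) (def_pblock tP IP jI).
have BJ : B *m restrict_to J x = 0.
  apply: (IH J j) => //; rewrite -ltnS; apply: leq_trans lem; rewrite Aii0 in ij.
  rewrite ltnS; apply: proper_card; apply/properP; split.
    by apply/fintype.subsetP => k; rewrite !inE; apply: lt_trans.
  by exists j; rewrite !inE ?ltxx.
have /colP/(_ i) := BJ; rewrite mulmx_restrict [RHS]mxE => BJi.
rewrite -[RHS]BJi; apply: eq_bigl => k.
by have [kJ|//] := boolP (k \in J); rewrite (rowJ J j k) // Aij eqxx.
Qed.

(** Conversely, the entry A i j depends only on the block of j, so that the
    n-th powers factor out of the contribution of each block. *)
Lemma hadamard_exp_ker A B n x :
  {in col_partition A, forall I, B *m restrict_to I x = 0} ->
  hadamard B (hadamard_exp A n) *m x = 0.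
Proof.
move=> Bx; apply/colP => i; rewrite [RHS]mxE.
rewrite (mulmx_restrict_partition _ _ _ (preim_partitionP (fun i => col i A) _)).
rewrite big1 // => I IP; have [->|[k kI]] := set_0Vmem I.
  by rewrite big_set0.
rewrite (eq_bigr (fun j => A i k ^+ n * (B i j * x j 0))) => [|j jI].
  by rewrite -big_distrr -mulmx_restrict Bx //= mxE mulr0.
have /eqP/colP/(_ i) : col j A == col k A by rewrite -(mem_col_partition j IP kI).
by rewrite !mxE => ->; rewrite mulrCA mulrA.
Qed.

End Psd.
(** * The three kernels *)

Local Open Scope complex_scope.

Theorem theorem5p7 (R : realType) (N : nat) (hN : (0 < N)%N)
    (A : 'M[R[i]]_N) (hA : psdmx A)
    (B : 'M[R[i]]_N) (hB : psdmx B) (hB0 : forall i : 'I_N, B i i != 0)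
    (c : 'I_N -> R) (hc : forall n : 'I_N, 0 < c n) :
  (exists! P : {set {set 'I_N}}, const_blocks_partition A P) /\
  forall P : {set {set 'I_N}}, const_blocks_partition A P ->
    mxker (hadamard B (\sum_(n < N) (c n)%:C *: hadamard_exp A n))
      = \bigcap_(n in [set: nat]) mxker (hadamard B (hadamard_exp A n)) /\
    \bigcap_(n in [set: nat]) mxker (hadamard B (hadamard_exp A n))
      = block_dsum P (fun I : {set 'I_N} => mxker (princ_submx B I)).
Proof.
split.
  exists (col_partition A); split; first exact/const_blocks_partitionP.
  by move=> P /const_blocks_partitionP ->.
move=> P /const_blocks_partitionP -> //.
have Ppart : finset.partition (col_partition A) [set: 'I_N]%SET.
  exact: preim_partitionP.
have E : hadamard B (\sum_(n < N) (c n)%:C *: hadamard_exp A n) =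
    \sum_(n < N) (c n)%:C *: hadamard B (hadamard_exp A n).
  apply/matrixP => i j; rewrite mxE !summxE big_distrr /=.
  by apply: eq_bigr => n _; rewrite !mxE mulrCA.
split; apply/seteqP; split=> x.
- rewrite /mxker /= E => Mx n _; apply: hadamard_exp_ker.
  apply: ker_hadamard_restrict => //; apply: (mxker_psd_combination _ _ Mx) => k.
    exact: psdmx_hadamard_exp.
  by rewrite ltcR.
- move=> Hx; rewrite /mxker /= E mulmx_suml big1 // => n _.
  by rewrite -scalemxAl (Hx n I) scaler0.
- move=> Hx; apply/block_dsum_kerP => //; apply: ker_hadamard_restrict => // n.
  exact: Hx.
- by move=> /(block_dsum_kerP _ hB Ppart) Bx n _; apply: hadamard_exp_ker.
Qed.
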